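(* There exist absolute constants $c,C>0$ such that the following holds. Let $p=p(n)$ satisfy $p\gg 1/n$ and $p=o(1)$, let $G\sim G(n,n,p)$, and write $np=he^{h}$ with $h=h(n)>0$. Then, with high probability, both of the following statements hold. (i) Every $2$-edge-coloring of $G$ contains two monochromatic connected components $C_1$ and $C_2$ such that $|C_1\cup C_2|\geq 2n-Cne^{-h}$. (ii) There exists a $2$-edge-coloring of $G$ such that every pair of monochromatic connected components $C_1$ and $C_2$ satisfies $|C_1\cup C_2|\leq 2n-cne^{-h}$.
   Context: $G(n,n,p)$ is the binomial random bipartite graph with two parts $A,B$ of $n$ labelled vertices each, every pair in $A\times B$ being an edge independently with probability $p$. Asymptotics are as $n\to\infty$; $p\gg 1/n$ means $np\to\infty$, and ''with high probability'' means with probability tending to $1$. The number $h=h(n)$ is the unique positive real with $he^h=np$. A $2$-edge-coloring assigns to each edge one of two colors arbitrarily (not necessarily properly). A monochromatic connected component is a connected component of the spanning subgraph formed by all edges of one color; it is identified with its vertex set, so $|C_1\cup C_2|$ is the number of vertices covered by the two components, which may be of the same or of different colors. *)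

(* Defs.v *)
From mathcomp Require Import all_boot all_order all_algebra.
From mathcomp Require Import all_classical all_reals all_analysis.

Set Implicit Arguments.
Unset Strict Implicit.
Unset Printing Implicit Defensive.

Import Order.TTheory GRing.Theory Num.Theory.
Import numFieldNormedType.Exports.

Local Open Scope classical_set_scope.
Local Open Scope ring_scope.

(* The parts are A = inl @: 'I_n and B = inr @: 'I_n; a bipartite graph is
   given by its edge set, as a subset of A x B. *)
Definition vertex (n : nat) : finType := ('I_n + 'I_n)%type.
Definition bigraph (n : nat) : finType := {set 'I_n * 'I_n}.

(* The probability that G(n,n,p) satisfies P. *)
Definition Gnnp_prob (R : realType) (n : nat) (p : R) (P : bigraph n -> Prop) : R :=
  \sum_(G : bigraph n | `[< P G >])
    \prod_(e : 'I_n * 'I_n) (if e \in G then p else 1 - p).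

Definition whp (R : realType) (p : nat -> R)
    (P : forall n : nat, bigraph n -> Prop) : Prop :=
  Gnnp_prob (p n) (P n) @[n --> \oo] --> (1 : R).

(* The values of a colouring outside the edge set of the graph are ignored, see
   [mono_adj]. *)
Definition coloring (n : nat) : finType := {ffun 'I_n * 'I_n -> bool}.

Definition mono_adj (n : nat) (G : bigraph n) (col : coloring n) (k : bool) :
    rel (vertex n) :=
  fun u v =>
    match u, v with
    | inl a, inr b | inr b, inl a => ((a, b) \in G) && (col (a, b) == k)
    | _, _ => false
    end.

(* A component carries its colour, as a red and a blue component may have the
   same vertex set. Isolated vertices of a colour class are components. *)
Definition mono_component (n : nat) (G : bigraph n) (col : coloring n)
    (C : bool * {set vertex n}) : Prop :=
  exists u : vertex n, C.2 = [set v | connect (mono_adj G col C.1) u v]%SET.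

(* Main.v *)
Require Import Defs.
From mathcomp Require Import all_boot all_order all_algebra.
From mathcomp Require Import all_classical all_reals all_analysis.
From mathcomp Require Import zify ring lra.

Import Order.TTheory GRing.Theory Num.Theory.
Import numFieldNormedType.Exports.

Set Implicit Arguments.
Unset Strict Implicit.
Unset Printing Implicit Defensive.

(** Write s = n e^{-h}, which equals h/p because h e^h = np. The number s is the
    scale of the largest hole of G, that is, of the largest X in A and Y in B of
    equal size with no edge between them, and both halves of the theorem follow
    from deterministic facts about holes.

    Upper bound on holes. For m about 4s, the expected number of m by m holes is
    at most 'C(n, m)^2 (1 - p)^(m^2), and 'C(n, m) <= e^((1 + h) m) while
    (1 - p)^(m^2) <= e^(- 4 h m); so with probability at least 1 - 1/h there is
    no such hole ([Gnnp_prob_hole_le]).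

    A graph without m by m holes behaves, up to errors O(m), like a complete
    bipartite graph, for which the covering statement is elementary. Namely, if
    all edges between X and Y have one colour, then one component of that colour
    misses fewer than m vertices of each of X and Y ([giant_component]). If some
    union S of red components has large traces on and large complements in both
    parts, all edges leaving S are blue, and the two pairs of sets joined by
    them give two blue components which cover everything but 4m vertices.
    Otherwise some component, red or blue, covers nearly all of one part; the
    vertices of the other part outside it see only the other colour there, and
    one more component collects them ([cover_of_half]). This is
    [two_components_cover], which yields (i).

    Lower bound on holes. Fix X of size 2t with t about s/4. Every vertex of B
    misses X with probability (1 - p)^(2t) >= e^(- h), so about s of them do,
    and Chebyshev's inequality gives at least t of them with probability at
    least 1 - 4/h ([Gnnp_prob_no_hole]). Such a hole (X, Y) produces the
    colouring of (ii): halve X into X1 and X2, colour blue the edges at X1 and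
    the edges at Y, and colour red all the others. Then no component, red or
    blue, meets two of the sets X1, X2, Y, so two components always leave one of
    the three uncovered ([hole_coloring]).

    Since h tends to infinity with np, the failure probability 5/h tends to 0. *)

(** * Covering by two monochromatic components *)

Section Subset.

Import mathcomp.boot.fintype mathcomp.boot.finset.
Local Open Scope nat_scope.

Lemma exists_subset_card (T : finType) (A : {set T}) m :
  m <= #|A| -> exists2 B : {set T}, B \subset A & #|B| = m.
Proof.
move=> /card_geqP[s [us ss sA]]; exists [set x in s]%SET.
  by apply/fintype.subsetP=> x; rewrite inE; apply: sA.
by rewrite cardsE -ss; apply/card_uniqP.
Qed.

End Subset.

Section Covering.

Import mathcomp.boot.fintype mathcomp.boot.finset mathcomp.boot.fingraph.
Local Open Scope nat_scope.

Variables (V : finType) (side : V -> bool) (r : bool -> rel V) (m : nat).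

Definition part s : {set V} := [set v | side v == s].
Definition component k u : {set V} := [set v | connect (r k) u v].

Hypothesis m_gt0 : 0 < m.
Hypothesis r_sym : forall k, symmetric (r k).
Hypothesis joined : forall s (X Y : {set V}),
  X \subset part s -> Y \subset part (~~ s) -> m <= #|X| -> m <= #|Y| ->
  exists x y k, [/\ x \in X, y \in Y & r k x y].

Lemma closed_component k u : closed (r k) (component k u).
Proof.
move=> x y rxy; rewrite !inE; apply: same_connect_r; last exact: connect1.
exact/sym_connect_sym.
Qed.

Lemma closed_setD k (S T : {set V}) :
  closed (r k) S -> closed (r k) T -> closed (r k) (S :\: T).
Proof. by move=> clS clT x y rxy; rewrite !inE (clS _ _ rxy) (clT _ _ rxy). Qed.

(** A closed set of vertices is a union of components. Adding components one at
    a time until the union S has at least a elements in X or in Y, all that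
    precedes the last component is below a in both, so that S and its last
    component are interchangeable up to a. Minimality of S stands for the moment
    at which one stops adding. *)
Lemma exists_dominating_component k (X Y : {set V}) a : 0 < a -> a <= #|X| ->
  exists (S : {set V}) u,
    [/\ closed (r k) S, (a <= #|X :&: S|) || (a <= #|Y :&: S|),
        #|X :\: component k u| < #|X :\: S| + a &
        #|Y :\: component k u| < #|Y :\: S| + a].
Proof.
move=> a_gt0 leaX.
pose good (S : {set V}) :=
  [forall x, forall y, r k x y ==> ((x \in S) == (y \in S))]
  && ((a <= #|X :&: S|) || (a <= #|Y :&: S|)).
have closedP (S : {set V}) :
    reflect (closed (r k) S)
      [forall x, forall y, r k x y ==> ((x \in S) == (y \in S))].
  apply: (iffP forallP) => [clS x y rxy | clS x].
    by apply/eqP; move/forallP/(_ y)/implyP: (clS x); apply.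
  by apply/forallP=> y; apply/implyP=> rxy; apply/eqP; apply: clS.
have goodT : good [set: V].
  by rewrite /good setIT leaX andbT; apply/closedP=> x y _; rewrite !inE.
case: (arg_minnP (fun S : {set V} => #|S|) goodT) => S /andP[/closedP clS bigS] minS.
have [u uS] : exists u, u \in S.
  apply/set0Pn/eqP => S0; move: bigS; rewrite S0 !setI0 cards0.
  by rewrite orbb leqNgt a_gt0.
have splitD (Z : {set V}) :
    #|Z :\: component k u| <= #|Z :\: S| + #|Z :&: (S :\: component k u)|.
  apply: leq_trans (leq_card_setU _ _); apply: subset_leq_card.
  by apply/subsetP=> x; rewrite !inE; case: (x \in S); case: (x \in Z); case: connect.
have : ~~ good (S :\: component k u).
  apply/negP=> /minS; rewrite leqNgt => /negP; apply; apply: proper_card.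
  apply/properP; split; first exact: subsetDl.
  by exists u; rewrite // !inE connect0.
rewrite negb_and (introT (closedP _)) /=; last exact: closed_setD (@closed_component k u).
rewrite negb_or -!ltnNge => /andP[ltX ltY].
exists S, u; split=> //.
- by apply: leq_ltn_trans (splitD X) _; rewrite ltn_add2l.
- by apply: leq_ltn_trans (splitD Y) _; rewrite ltn_add2l.
Qed.

(** A closed set that takes m elements of X must take almost all of Y, because
    the vertices of X inside and those of Y outside it would form a hole. *)
Lemma closed_absorbs s k (X Y S : {set V}) :
  X \subset part s -> Y \subset part (~~ s) ->
  {in X & Y, forall x y, ~~ r (~~ k) x y} -> closed (r k) S ->
  m <= #|X :&: S| -> #|Y :\: S| < m.
Proof.
move=> sX sY pure clS leX; rewrite ltnNge; apply/negP=> leY.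
have sXS : X :&: S \subset part s by apply: subset_trans sX; apply: subsetIl.
have sYS : Y :\: S \subset part (~~ s) by apply: subset_trans sY; apply: subsetDl.
have [x [y [k' []]]] := joined sXS sYS leX leY.
rewrite !inE => /andP[xX xS] /andP[yS yY] rxy.
have [ekk'|nkk'] := eqVneq k' k.
  by rewrite ekk' in rxy; rewrite (clS _ _ rxy) (negbTE yS) in xS.
by move: (pure x y xX yY); rewrite (_ : ~~ k = k') ?rxy //; case: (k) (k') nkk' => [] [].
Qed.

(** A union of components that reaches m on one side swallows all but m of the
    other side, which is then at least 2m, and so of the first side as well. The
    dominating component loses at most m more, and what is left of it still has
    at least m elements: this is why 3m is asked for. *)
Lemma giant_component s k (X Y : {set V}) :
  X \subset part s -> Y \subset part (~~ s) ->
  {in X & Y, forall x y, ~~ r (~~ k) x y} ->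
  3 * m <= #|X| -> 3 * m <= #|Y| ->
  exists u, #|X :\: component k u| < m /\ #|Y :\: component k u| < m.
Proof.
move=> sX sY pure leX leY.
have sX' : X \subset part (~~ ~~ s) by rewrite negbK.
have pure' : {in Y & X, forall x y, ~~ r (~~ k) x y}.
  by move=> x y xY yX; rewrite r_sym; apply: pure.
have absX S := @closed_absorbs s k X Y S sX sY pure.
have absY S := @closed_absorbs (~~ s) k Y X S sY sX' pure'.
have [|S [u [clS bigS ltX ltY]]] := @exists_dominating_component k X Y m m_gt0 _.
  by lia.
exists u; have := @closed_component k u; move: ltX ltY.
move: (component k u) => D ltX ltY clD.
move: (absX S clS) (absY S clS) (absX D clD) (absY D clD).
by move: bigS (cardsID S X) (cardsID S Y) (cardsID D X) (cardsID D Y); lia.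
Qed.

Lemma closed_pure k (X Y S : {set V}) : closed (r k) S ->
  {in X :&: S & Y :\: S, forall x y, ~~ r k x y}.
Proof.
move=> clS x y; rewrite !inE => /andP[_ xS] /andP[yS _].
by apply/negP => rxy; rewrite -(clS _ _ rxy) xS in yS.
Qed.

Lemma card_setC_parts s (T : {set V}) :
  #|~: T| <= #|part s :\: T| + #|part (~~ s) :\: T|.
Proof.
apply: leq_trans (leq_card_setU _ _); apply: subset_leq_card.
by apply/subsetP=> x; rewrite !inE => ->; case: (side x); case: s.
Qed.

(** Once a component D fills one part up to q vertices, the rest of the other
    part sends only edges of the other colour to D. If that rest is of order m,
    it may be ignored; if not, it spans with D a component of the other colour
    that contains all but m of it. *)
Lemma cover_of_half s k u q :
  q + 3 * m <= #|part s| -> #|part s :\: component k u| <= q ->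
  exists v, #|~: (component k u :|: component (~~ k) v)| <= q + 3 * m.
Proof.
move=> les; set D := component k u => leq.
have bound v : #|~: (D :|: component (~~ k) v)| <=
    q + #|(part (~~ s) :\: D) :\: component (~~ k) v|.
  apply: leq_trans (card_setC_parts s _) _.
  rewrite -setDDl -[in X in _ + X]setDDl leq_add2r.
  by apply: leq_trans leq; apply: subset_leq_card; apply: subsetDl.
have [ltX|leX] := ltnP #|part (~~ s) :\: D| (3 * m).
  exists u; apply: leq_trans (bound u) _; rewrite leq_add2l.
  by apply: leq_trans (ltnW ltX); apply: subset_leq_card; apply: subsetDl.
have leY : 3 * m <= #|part s :&: D|.
  by move: (cardsID D (part s)); lia.
have [|||v [_ ltv]] := @giant_component s (~~ k) (part s :&: D) (part (~~ s) :\: D) _ _ _ leY leX.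
- exact: subsetIl.
- exact: subsetDl.
- by rewrite negbK; apply: closed_pure; apply: closed_component.
by exists v; apply: leq_trans (bound v) _; lia.
Qed.

(** The colour is compared along with the vertex set, so that a component of
    each colour always counts as two. *)
Lemma two_components_cover : (forall s, 9 * m <= #|part s|) ->
  exists k1 u1 k2 u2, (k1, component k1 u1) != (k2, component k2 u2) /\
    #|~: (component k1 u1 :|: component k2 u2)| <= 9 * m.
Proof.
move=> big.
have half s k u : #|part s :\: component k u| <= 6 * m ->
  exists k1 u1 k2 u2, (k1, component k1 u1) != (k2, component k2 u2) /\
    #|~: (component k1 u1 :|: component k2 u2)| <= 9 * m.
  move=> leq; have [|v lev] := @cover_of_half s k u (6 * m) _ leq.
    by move: (big s); lia.
  exists k, u, (~~ k), v; split; last by move: lev; lia.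
  by apply/eqP=> -[]; case: k {leq lev}.
have [||S [u [clS bigS ltX ltY]]] :=
    @exists_dominating_component true (part true) (part false) (3 * m) _ _.
- by lia.
- by move: (big true); lia.
have pureS X Y : {in X :&: S & Y :\: S, forall x y, ~~ r (~~ false) x y}.
  exact: closed_pure.
have giantS s : 3 * m <= #|part s :&: S| -> 3 * m <= #|part (~~ s) :\: S| ->
  exists v, #|(part s :&: S) :\: component false v| < m /\
            #|(part (~~ s) :\: S) :\: component false v| < m.
  by apply: (@giant_component s); rewrite ?subsetIl ?subsetDl //; apply: pureS.
have [ltXS|leXS] := ltnP #|part true :\: S| (3 * m).
  by apply: (half true true u); lia.
have [ltYS|leYS] := ltnP #|part false :\: S| (3 * m).
  by apply: (half false true u); lia.
have splitS s v : #|part s :\: component false v| <=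
    #|part s :&: S :\: component false v| + #|part s :\: S :\: component false v|.
  apply: leq_trans (leq_card_setU _ _); apply: subset_leq_card.
  by apply/subsetP=> x; rewrite !inE; case: (x \in S); case: connect; case: (side x == s).
(* A union S that is small in one part and large in the other sends only blue
   edges from its large trace to nearly the whole of the first part, which is
   hence nearly filled by one blue component. *)
have small s : #|part s :&: S| < 3 * m ->
    3 * m <= #|part (~~ s) :&: S| ->  3 * m <= #|part s :\: S| ->
    exists k1 u1 k2 u2, (k1, component k1 u1) != (k2, component k2 u2) /\
    #|~: (component k1 u1 :|: component k2 u2)| <= 9 * m.
  move=> lts leNs leDs.
  have := @giantS (~~ s) leNs; rewrite negbK => /(_ leDs)[v [_ ltv]].
  apply: (half s false v); apply: leq_trans (splitS s v) _.
  have : #|part s :&: S :\: component false v| <= #|part s :&: S|.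
    by apply: subset_leq_card; apply: subsetDl.
  by lia.
have [ltXI|leXI] := ltnP #|part true :&: S| (3 * m).
  by apply: (small true) => //=; move: bigS; lia.
have [ltYI|leYI] := ltnP #|part false :&: S| (3 * m).
  exact: (small false).
(* S is large, with large complement, in both parts: two blue components. *)
have [v [v1 v2]] := giantS true leXI leYS.
have [w [w1 w2]] := giantS false leYI leXS.
have cover : #|~: (component false v :|: component false w)| <= 4 * m.
  apply: leq_trans (card_setC_parts true _) _ => /=.
  have sub (T T' : {set V}) x : #|T :\: component false x| < m ->
      T' \subset T :\: component false x -> #|T'| < m.
    by move=> ltm /subset_leq_card leT; apply: leq_ltn_trans leT ltm.
  have := cardsID S (part true :\: (component false v :|: component false w)).
  have := cardsID S (part false :\: (component false v :|: component false w)).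
  have t1 : #|(part true :\: (component false v :|: component false w)) :&: S| < m.
    apply: sub v1 _; apply/subsetP => x; rewrite !inE.
    by case: (connect _ v x); case: (connect _ w x); case: (x \in S); case: (side x).
  have t2 : #|(part false :\: (component false v :|: component false w)) :\: S| < m.
    apply: sub v2 _; apply/subsetP => x; rewrite !inE.
    by case: (connect _ v x); case: (connect _ w x); case: (x \in S); case: (side x).
  have t3 : #|(part false :\: (component false v :|: component false w)) :&: S| < m.
    apply: sub w1 _; apply/subsetP => x; rewrite !inE.
    by case: (connect _ v x); case: (connect _ w x); case: (x \in S); case: (side x).
  have t4 : #|(part true :\: (component false v :|: component false w)) :\: S| < m.
    apply: sub w2 _; apply/subsetP => x; rewrite !inE.
    by case: (connect _ v x); case: (connect _ w x); case: (x \in S); case: (side x).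
  by lia.
(* The two blue components may be one and the same; any red component then
   serves as the second one. *)
have [evw|nvw] := eqVneq (component false v) (component false w).
  exists false, v, true, v; split; first by apply/eqP=> -[].
  move: cover; rewrite -evw setUid => cover.
  have : #|~: (component false v :|: component true v)| <= #|~: component false v|.
    by apply: subset_leq_card; rewrite setCU; apply: subsetIl.
  by lia.
exists false, v, false, w; split; last by lia.
by apply: contra nvw => /eqP[->].
Qed.

End Covering.

(** * Holes in bipartite graphs *)

Section Graph.

Import mathcomp.boot.fintype mathcomp.boot.finset mathcomp.boot.fingraph.
Local Open Scope nat_scope.

Variable n : nat.
Implicit Types (G : bigraph n) (col : coloring n).

Definition hole_free m G := forall X Y : {set 'I_n},
  #|X| = m -> #|Y| = m -> ~~ [disjoint setX X Y & G].

Definition in_left (v : vertex n) := if v is inl _ then true else false.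

Lemma card_preim_part s (X : {set vertex n}) : X \subset part in_left s ->
  #|(if s then inl else inr) @^-1: X| = #|X|.
Proof.
move=> /fintype.subsetP sX; rewrite -(@card_imset _ _ (if s then inl else inr)).
  apply: eq_card => v; apply/imsetP/idP => [[a]|vX]; first by rewrite inE => aX ->.
  move: vX (sX v vX); rewrite [v \in part _ _]inE.
  by case: s {sX}; case: v => //= a aX _; exists a; rewrite ?inE.
by case: s {sX} => a b [].
Qed.

Lemma card_part s : #|part in_left s| = n.
Proof.
rewrite -(@card_preim_part s) // -[RHS]card_ord -cardsT; apply: eq_card => a.
by rewrite !inE; case: s.
Qed.

Lemma mono_adj_sym G col k : symmetric (mono_adj G col k).
Proof. by move=> [a|b] [a'|b']. Qed.

Lemma hole_free_joined G col m s (X Y : {set vertex n}) : hole_free m G ->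
  X \subset part in_left s -> Y \subset part in_left (~~ s) ->
  m <= #|X| -> m <= #|Y| ->
  exists x y k, [/\ x \in X, y \in Y & mono_adj G col k x y].
Proof.
move=> hfG; wlog -> : s X Y / s = true => [wlg|] sX sY leX leY.
  case: s sX sY => sX sY; first exact: (wlg true).
  have [x [y [k [? ? ?]]]] := wlg true Y X erefl sY sX leY leX.
  by exists y, x, k; rewrite mono_adj_sym.
rewrite -(card_preim_part sX) in leX; rewrite -(card_preim_part sY) in leY.
have [X' /fintype.subsetP sX' cX] := exists_subset_card leX.
have [Y' /fintype.subsetP sY' cY] := exists_subset_card leY.
have /fintype.pred0Pn[[a b] /andP[/= + abG]] := hfG _ _ cX cY.
rewrite !inE => /andP[/= /sX' + /sY']; rewrite !inE => aX bY.
by exists (inl a), (inr b), (col (a, b)); split; rewrite //= abG eqxx.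
Qed.

Lemma card_vertex : #|{: vertex n}| = 2 * n.
Proof. by rewrite card_sum card_ord mul2n addnn. Qed.

(** The bound is 18m rather than 9m to include the graphs with n < 9m, where it
    is trivial and only the existence of two components matters. *)
Lemma hole_free_two_components m G col : 0 < n -> 0 < m -> hole_free m G ->
  exists C1 C2 : bool * {set vertex n},
    [/\ mono_component G col C1, mono_component G col C2, C1 <> C2 &
        2 * n <= #|C1.2 :|: C2.2| + 18 * m].
Proof.
move=> n_gt0 m_gt0 hfG; pose r := mono_adj G col.
have [le9|lt9] := leqP (9 * m) n; last first.
  pose u : vertex n := inl (Ordinal n_gt0).
  exists (true, component r true u), (false, component r false u).
  by split; [exists u | exists u | case | lia].
have [||s|k1 [u1 [k2 [u2 [/eqP neC cov]]]]] := @two_components_cover _ in_left r m m_gt0.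
- exact: mono_adj_sym.
- by move=> s X Y; apply: hole_free_joined.
- by rewrite card_part.
exists (k1, component r k1 u1), (k2, component r k2 u2); split => //.
- by exists u1.
- by exists u2.
set U := (X in ~: X) in cov; suff: 2 * n <= #|U| + 18 * m by [].
by rewrite -card_vertex -(cardsC U); lia.
Qed.

Lemma mono_component_label (T : Type) (lam : bool -> vertex n -> T) G col C :
  (forall k u v, mono_adj G col k u v -> lam k u = lam k v) ->
  mono_component G col C -> exists i, {in C.2, forall v, lam C.1 v = i}.
Proof.
move=> lamP [u ->]; exists (lam C.1 u) => v; rewrite inE => /connectP[w].
elim: w u => [|x w IH] u /=; first by move=> _ ->.
by move=> /andP[/lamP -> pw] /(IH _ pw).
Qed.

(** The colouring is certified by a labelling of the vertices, one for each
    colour, that is constant on the components of that colour and takes on X1,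
    X2 and Y the values 0, 1 and 2 in both colours. A component thus meets at
    most one of these three sets. *)
Lemma hole_coloring G (X1 X2 Y : {set 'I_n}) t :
  [disjoint X1 & X2] -> [disjoint setX (X1 :|: X2) Y & G] ->
  t <= #|X1| -> t <= #|X2| -> t <= #|Y| ->
  exists col, forall C1 C2,
    mono_component G col C1 -> mono_component G col C2 ->
    #|C1.2 :|: C2.2| + t <= 2 * n.
Proof.
move=> dX hole tX1 tX2 tY.
pose col : coloring n := [ffun e => (e.1 \notin X1) && (e.2 \notin Y)].
pose lam k (v : vertex n) := match k, v with
  | true, inl a => if a \in X1 then 0 else 1
  | true, inr b => if b \in Y then 2 else 1
  | false, inl a => if a \in X1 then 0 else if a \in X2 then 1 else 2
  | false, inr b => if b \in Y then 2 else 0 end.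
have lamE k a b : mono_adj G col k (inl a) (inr b) -> lam k (inl a) = lam k (inr b).
  move=> /= /andP[abG]; rewrite ffunE /= => /eqP <-.
  have := disjointFl hole abG; rewrite !inE /lam /=.
  by case: (a \in X1); case: (b \in Y); case: (a \in X2).
have lamP k u v : mono_adj G col k u v -> lam k u = lam k v.
  case: u v => [a|b] [a'|b'] //; first exact: lamE.
  by rewrite mono_adj_sym => /lamE.
exists col => C1 C2 /(mono_component_label lamP)[i Ci] /(mono_component_label lamP)[j Cj].
have miss l (T : {set vertex n}) : i != l -> j != l -> t <= #|T| ->
    (forall k, {in T, forall v, lam k v = l}) -> #|C1.2 :|: C2.2| + t <= 2 * n.
  move=> nil njl tT lamT; apply: leq_trans (_ : #|C1.2 :|: C2.2| + #|T| <= _).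
    by rewrite leq_add2l.
  rewrite -card_vertex -(cardsC (C1.2 :|: C2.2)) leq_add2l.
  apply: subset_leq_card; apply/fintype.subsetP => v vT; rewrite !inE negb_or.
  apply/andP; split; apply/negP.
    by move=> /Ci; rewrite (lamT _ v vT) => eil; rewrite eil eqxx in nil.
  by move=> /Cj; rewrite (lamT _ v vT) => ejl; rewrite ejl eqxx in njl.
have missX1 : i != 0 -> j != 0 -> #|C1.2 :|: C2.2| + t <= 2 * n.
  move=> ni nj; apply: (miss 0 (inl @: X1)) => //.
    by rewrite card_imset // => a b [].
  by move=> [] _ /imsetP[a aX ->] /=; rewrite aX.
have missX2 : i != 1 -> j != 1 -> #|C1.2 :|: C2.2| + t <= 2 * n.
  move=> ni nj; apply: (miss 1 (inl @: X2)) => //.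
    by rewrite card_imset // => a b [].
  by move=> [] _ /imsetP[a aX ->] /=; rewrite (disjointFl dX aX) ?aX.
have missY : i != 2 -> j != 2 -> #|C1.2 :|: C2.2| + t <= 2 * n.
  move=> ni nj; apply: (miss 2 (inr @: Y)) => //.
    by rewrite card_imset // => a b [].
  by move=> [] _ /imsetP[a aX ->] /=; rewrite aX.
(* Two labels i and j always leave out one of 0, 1 and 2. *)
have [i0|ni0] := eqVneq i 0.
  have [j1|nj1] := eqVneq j 1; first by apply: missY; rewrite ?i0 ?j1.
  by apply: missX2; rewrite ?i0.
have [j0|nj0] := eqVneq j 0; last exact: missX1.
have [i1|ni1] := eqVneq i 1; first by apply: missY; rewrite ?i1 ?j0.
by apply: missX2; rewrite ?j0.
Qed.

End Graph.

(** * The probability space G(n,n,p) *)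

Local Open Scope ring_scope.

Section Weights.

Variables (R : realType) (n : nat) (p : R).
Hypotheses (p_ge0 : 0 <= p) (p_le1 : p <= 1).

Definition weight (G : bigraph n) : R :=
  \prod_(e : 'I_n * 'I_n) (if e \in G then p else 1 - p).

Lemma weight_ge0 G : 0 <= weight G.
Proof.
by apply: prodr_ge0 => e _; case: ifP => _; rewrite ?subr_ge0.
Qed.

Lemma Gnnp_probE (P : bigraph n -> Prop) :
  Gnnp_prob p P = \sum_G weight G * (`[< P G >])%:R.
Proof.
rewrite /Gnnp_prob big_mkcond; apply: eq_bigr => G _.
by case: asbool; rewrite ?mulr1 ?mulr0.
Qed.

(** Expanding the product over all pairs e of (p + (1 - p)), with p replaced by
    0 on E, gives back the sum over the graphs that avoid E. The case of empty E
    says that the weights sum to 1. *)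
Lemma Gnnp_prob_avoid (E : {set 'I_n * 'I_n}) :
  Gnnp_prob p (fun G => [disjoint E & G]) = (1 - p) ^+ #|E|.
Proof.
rewrite Gnnp_probE.
transitivity (\prod_(e : 'I_n * 'I_n)
    ((if e \in E then 0 else p) + (1 - p))); last first.
  rewrite -prodr_const [RHS]big_mkcond /=; apply: eq_bigr => e _.
  by case: ifP => _; ring.
rewrite bigA_distr; apply: eq_bigr => G _; rewrite asboolb.
have [dEG|/fintype.pred0Pn[e /andP[/= eE eG]]] := boolP [disjoint E & G].
  rewrite mulr1; apply: eq_bigr => e _; case: ifP => // eG.
  by rewrite (disjointFl dEG eG).
by rewrite mulr0 (bigD1 e) //= eG eE mul0r.
Qed.

Lemma sum_weight : \sum_G weight G = 1.
Proof.
have := Gnnp_prob_avoid finset.set0; rewrite cards0 expr0 => <-.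
rewrite Gnnp_probE; apply: eq_bigr => G _.
by rewrite asboolb eq_disjoint0 ?mulr1 // => x; rewrite inE.
Qed.

Lemma Gnnp_prob_le1 (P : bigraph n -> Prop) : Gnnp_prob p P <= 1.
Proof.
rewrite Gnnp_probE -[leRHS]sum_weight; apply: ler_sum => G _.
by rewrite ler_piMr ?weight_ge0 // lern1 leq_b1.
Qed.

(** The union bound in the form in which it is used: the event P contains the
    complement of two bad events. *)
Lemma Gnnp_prob_cover (P Q1 Q2 : bigraph n -> Prop) :
  (forall G, [\/ P G, Q1 G | Q2 G]) ->
  1 <= Gnnp_prob p P + Gnnp_prob p Q1 + Gnnp_prob p Q2.
Proof.
move=> cov; rewrite !Gnnp_probE -!big_split /= -[leLHS]sum_weight.
apply: ler_sum => G _; rewrite -!mulrDr ler_peMr ?weight_ge0 //.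
by rewrite -!natrD ler1n; case: (cov G) => /asboolT ->; rewrite ?addn1.
Qed.

Lemma Gnnp_prob_union (I : finType) (A : {pred I}) (P : bigraph n -> Prop)
    (Q : I -> bigraph n -> Prop) :
  (forall G, P G -> exists2 i, i \in A & Q i G) ->
  Gnnp_prob p P <= \sum_(i in A) Gnnp_prob p (Q i).
Proof.
move=> PQ; under eq_bigr do rewrite Gnnp_probE.
rewrite Gnnp_probE exchange_big /=; apply: ler_sum => G _.
rewrite -mulr_sumr ler_wpM2l ?weight_ge0 // -natr_sum ler_nat.
case: (asboolP (P G)) => //= /PQ[i iA /asboolT Qi].
by rewrite (bigD1 i) //= Qi.
Qed.

Lemma Gnnp_prob_markov (P : bigraph n -> Prop) (f : bigraph n -> R) a :
  (forall G, 0 <= f G) -> (forall G, P G -> a <= f G) ->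
  a * Gnnp_prob p P <= \sum_G weight G * f G.
Proof.
move=> f0 Pf; rewrite Gnnp_probE mulr_sumr; apply: ler_sum => G _.
rewrite mulrCA ler_wpM2l ?weight_ge0 //.
by case: (asboolP (P G)) => [/Pf|_]; rewrite ?mulr1 ?mulr0.
Qed.

Definition nonneighbours (G : bigraph n) (X : {set 'I_n}) : {set 'I_n} :=
  [set b | [disjoint finset.setX X [set b] & G]]%SET.

Lemma card_nonneighbours G X : #|nonneighbours G X|%:R =
  \sum_b ([disjoint finset.setX X (finset.set1 b) & G])%:R :> R.
Proof.
by rewrite -natr_sum -sum1_card big_mkcond /=; congr _%:R;
  apply: eq_bigr => b _; rewrite inE; case: disjoint.
Qed.

(** Chebyshev's inequality for the number N of vertices of B without neighbour
    in X. Its mean is nq and, the vertices of B being independent, its variance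
    is at most nq; half of the mean is lost with probability at most
    nq / (nq/2)^2 = 4 / (nq). *)
Lemma Gnnp_prob_few_nonneighbours (X : {set 'I_n}) (q := (1 - p) ^+ #|X|) :
  (n%:R * q) * Gnnp_prob p (fun G => #|nonneighbours G X|%:R < n%:R * q / 2) <= 4.
Proof.
have q0 : 0 <= q by rewrite exprn_ge0 // subr_ge0.
have [->|nq_neq0] := eqVneq (n%:R * q) 0; first by rewrite mul0r.
have nq_gt0 : 0 < n%:R * q by rewrite lt_neqAle eq_sym nq_neq0 mulr_ge0.
pose N G : R := #|nonneighbours G X|%:R.
have EN : \sum_G weight G * N G = n%:R * q.
  under eq_bigr do rewrite /N card_nonneighbours mulr_sumr.
  rewrite exchange_big /=.
  rewrite (eq_bigr (fun=> q)) ?sumr_const ?card_ord ?mulr_natl //.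
  move=> b _; rewrite /q -[#|X|]muln1 -(cards1 b) -cardsX -Gnnp_prob_avoid Gnnp_probE.
  by apply: eq_bigr => G _; rewrite asboolb.
(* The pairs with b = b' contribute nq, the others at most (nq)^2. *)
have EN2 : \sum_G weight G * N G ^+ 2 <= n%:R * q + (n%:R * q) ^+ 2.
  have -> : \sum_G weight G * N G ^+ 2 =
      \sum_(b : 'I_n) \sum_(b' : 'I_n) (1 - p) ^+ #|finset.setX X [set b; b']%SET|.
    under [RHS]eq_bigr do under eq_bigr do rewrite -Gnnp_prob_avoid Gnnp_probE.
    under [RHS]eq_bigr do rewrite exchange_big /=.
    rewrite exchange_big /=; apply: eq_bigr => G _.
    under [RHS]eq_bigr do rewrite -mulr_sumr.
    rewrite -mulr_sumr; congr (_ * _); rewrite /N card_nonneighbours expr2.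
    rewrite mulr_suml; apply: eq_bigr => b _; rewrite mulr_sumr.
    apply: eq_bigr => b' _; rewrite asboolb -natrM mulnb; congr (nat_of_bool _)%:R.
    apply/andP/idP => [[d d']|d].
      apply/finset.setDidPl/finset.setP => -[x y]; rewrite !inE /=.
      apply: andb_idl => /andP[xX /orP[]/eqP->]; apply/negP=> xyG.
        by have := disjointFl d xyG; rewrite !inE xX eqxx.
      by have := disjointFl d' xyG; rewrite !inE xX eqxx.
    split; apply: disjointWl d; apply/fintype.subsetP => -[x y]; rewrite !inE /=;
      by move=> /andP[-> ->]; rewrite ?orbT.
  have -> : n%:R * q + (n%:R * q) ^+ 2 = \sum_(b < n) (q + n%:R * q ^+ 2).
    by rewrite sumr_const card_ord -mulr_natl; ring.
  apply: ler_sum => b _; rewrite (bigD1 b) //= finset.setUid cardsX cards1 muln1.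
  rewrite lerD2l mulr_natl -[n in leRHS]card_ord -sumr_const.
  rewrite big_mkcond /=; apply: ler_sum => b' _.
  case: eqP => /= [_|/eqP nbb]; first by rewrite exprn_ge0.
  by rewrite cardsX cards2 eq_sym nbb exprM.
have var : \sum_G weight G * (N G - n%:R * q) ^+ 2 <= n%:R * q.
  have -> : \sum_G weight G * (N G - n%:R * q) ^+ 2 =
      \sum_G weight G * N G ^+ 2 - 2 * (n%:R * q) * \sum_G weight G * N G
      + (n%:R * q) ^+ 2 * \sum_G weight G.
    rewrite !mulr_sumr -sumrB -big_split /=; apply: eq_bigr => G _.
    by ring.
  by rewrite EN sum_weight; move: EN2; nra.
set P := (X in Gnnp_prob p X).
have := @Gnnp_prob_markov P (fun G => (N G - n%:R * q) ^+ 2) ((n%:R * q / 2) ^+ 2).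
move=> /(_ (fun G => sqr_ge0 _)) mk.
have {}mk : (n%:R * q / 2) ^+ 2 * Gnnp_prob p P <= n%:R * q.
  apply: le_trans (mk _) var => G; rewrite /P -/(N G) => ltN.
  by move: ltN nq_gt0; move: (N G) (n%:R * q) => u v; nra.
rewrite -(ler_pM2l nq_gt0).
by move: mk; move: (Gnnp_prob p P) (n%:R * q) => u v; lra.
Qed.

End Weights.

(** * Holes in the random graph *)

Section HighProbability.

Variables (R : realType) (n : nat) (p h : R).
Hypotheses (p_gt0 : 0 < p) (p_le1 : p <= 1).
Hypothesis hE : h * expR h = n%:R * p.

(** The quantity n e^{-h} of the theorem in the form in which it is compared with
    sizes of holes. *)
Lemma nexpRN : n%:R * expR (- h) = h / p.
Proof.
apply/eqP; rewrite -subr_eq0 -(mulIr_eq0 _ (mulIf (lt0r_neq0 p_gt0))) mulrBl.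
by rewrite mulrAC -hE -mulrA expRxMexpNx_1 mulr1 divfK ?lt0r_neq0 // subrr.
Qed.

(** The left-hand side is a term of the binomial expansion of (1 + z)^n. With
    z = m/n this is the usual bound (en/m)^m on 'C(n, m). *)
Lemma bin_le_expR m (z : R) : 0 <= z -> 'C(n, m)%:R * z ^+ m <= expR (n%:R * z).
Proof.
move=> z0; rewrite expRM_natl; apply: (@le_trans _ _ ((1 + z) ^+ n)); last first.
  by apply: lerXn2r; rewrite ?nnegrE ?addr_ge0 ?expR_ge0 // expR_ge1Dx.
have [lenm|ltnm] := leqP m n; last by rewrite bin_small // mul0r exprn_ge0 ?addr_ge0.
rewrite exprDn (bigD1 (Ordinal (lenm : m < n.+1)%N)) //= expr1n mul1r mulr_natl.
by rewrite lerDl sumr_ge0 // => i _; rewrite expr1n mul1r mulrn_wge0 // exprn_ge0.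
Qed.

(** The first moment bound over all pairs of m-element sets. *)
Lemma Gnnp_prob_hole m : Gnnp_prob p (fun G : bigraph n => ~ hole_free m G) <=
  'C(n, m)%:R ^+ 2 * (1 - p) ^+ (m * m).
Proof.
pose A := finset.setX [set X : {set 'I_n} | #|X| == m]%SET [set X : {set 'I_n} | #|X| == m]%SET.
apply: (@le_trans _ _ (\sum_(XY in A) (1 - p) ^+ (m * m))); last first.
  by rewrite sumr_const cardsX !card_draws card_ord -[leLHS]mulr_natl natrM expr2.
have := @Gnnp_prob_union R n p (ltW p_gt0) p_le1 _ (mem A)
  (fun G => ~ hole_free m G)
  (fun (XY : {set 'I_n} * {set 'I_n}) G => [disjoint finset.setX XY.1 XY.2 & G]).
move=> /(_ _)/le_trans; apply.
  move=> G; apply: contra_notP => noXY X Y cX cY; apply/negP => dXY.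
  by apply: noXY; exists (X, Y); rewrite // !inE /= cX cY eqxx.
apply: ler_sum => -[X Y]; rewrite !inE /= => /andP[/eqP cX /eqP cY].
by rewrite Gnnp_prob_avoid cardsX cX cY.
Qed.

Lemma Gnnp_prob_hole_le m : 2 <= h -> 4 * h <= m%:R * p ->
  Gnnp_prob p (fun G : bigraph n => ~ hole_free m G) <= h^-1.
Proof.
move=> h2 hm; apply: le_trans (Gnnp_prob_hole m) _.
have h_gt0 : 0 < h by lra.
have np_gt0 : 0 < n%:R * p by rewrite -hE mulr_gt0 ?expR_gt0.
have n_gt0 : 0 < n%:R :> R by rewrite pmulr_lgt0 in np_gt0.
have m_ge1 : 1 <= m%:R :> R.
  by rewrite ler1n lt0n; apply/eqP => m0; move: hm; rewrite m0 mul0r; lra.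
have binE : 'C(n, m)%:R <= expR ((1 + h) * m%:R).
  have z0 : 0 <= m%:R / n%:R :> R by rewrite divr_ge0.
  have := bin_le_expR m z0; rewrite mulrCA mulfV ?gt_eqF // mulr1 => le_bin.
  (* That is, n/m <= e^h: indeed m >= 4h/p and h/p = n e^{-h}. *)
  have le_z : expR (- h) <= m%:R / n%:R.
    by rewrite ler_pdivlMr // mulrC nexpRN ler_pdivrMr //; lra.
  have := lerXn2r m _ _ le_z; rewrite !nnegrE ?expR_ge0 z0 => /(_ isT isT).
  rewrite -expRM_natr => {}le_z.
  rewrite mulrDl mul1r expRD -ler_pdivrMr ?expR_gt0 // -expRN -mulNr.
  by apply: le_trans le_bin; apply: ler_wpM2l.
have le_1p : (1 - p) ^+ (m * m) <= expR (- p * m%:R * m%:R).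
  rewrite -mulrA -natrM expRM_natr; apply: lerXn2r; rewrite ?nnegrE ?expR_ge0 ?subr_ge0 //.
  exact: expR_ge1Dx.
apply: (@le_trans _ _ (expR (- h))); last first.
  rewrite expRN lef_pV2 ?posrE ?expR_gt0 //.
  by apply: le_trans (expR_ge1Dx h); rewrite lerDr.
apply: (@le_trans _ _ (expR ((1 + h) * m%:R) ^+ 2 * expR (- p * m%:R * m%:R))).
  apply: ler_pM => //; rewrite ?exprn_ge0 ?subr_ge0 //.
  by apply: lerXn2r; rewrite ?nnegrE ?expR_ge0.
(* The exponent is m (2 + 2h - pm) <= m (2 - 2h), and this is at most - h. *)
rewrite -expRM_natl -expRD ler_expR; nra.
Qed.

(** A vertex of B misses X with probability at least e^{-h}, as 1 - p is at least
    e^{-2p} and |X| p at most h/2. The expected number of such vertices is thus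
    at least h/p, hence at least 4t and at least h. *)
Lemma Gnnp_prob_no_hole (X : {set 'I_n}) t : 0 < h -> p <= 2^-1 ->
  4 * (t%:R * p) <= h -> #|X| = (2 * t)%N ->
  Gnnp_prob p (fun G => (#|nonneighbours G X| < t)%N) <= 4 / h.
Proof.
move=> h_gt0 p2 ht cX.
have q_ge : expR (- h) <= (1 - p) ^+ #|X|.
  apply: (@le_trans _ _ (expR (- (2 * p)) ^+ #|X|)).
    by rewrite -expRM_natl ler_expR cX natrM; nra.
  apply: lerXn2r; rewrite ?nnegrE ?expR_ge0 ?subr_ge0 //.
  have p_lt1 : 0 < 1 - p by lra.
  rewrite expRN -[leRHS]invrK lef_pV2 ?posrE ?invr_gt0 ?expR_gt0 //.
  apply: le_trans (expR_ge1Dx _).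
  have := mulr_ge0 (ltW p_gt0) (_ : 0 <= 1 - 2 * p); rewrite -[_^-1]mul1r ler_pdivrMr //.
  by move=> /(_ ltac:(lra)); lra.
have nq_ge : h <= n%:R * (1 - p) ^+ #|X| * p.
  by rewrite -ler_pdivrMr // -nexpRN ler_wpM2l.
have t_le : t%:R <= n%:R * (1 - p) ^+ #|X| / 2.
  by rewrite -(ler_pM2r p_gt0); lra.
pose P G := #|nonneighbours G X|%:R < n%:R * (1 - p) ^+ #|X| / 2.
have le4 := Gnnp_prob_few_nonneighbours (ltW p_gt0) p_le1 X : _ * Gnnp_prob p P <= 4.
have leP : Gnnp_prob p (fun G => (#|nonneighbours G X| < t)%N) <= Gnnp_prob p P.
  rewrite !Gnnp_probE; apply: ler_sum => G _; apply: ler_wpM2l.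
    by apply: weight_ge0 => //; apply: ltW.
  rewrite ler_nat; case: (asboolP (_ < t)%N) => // ltt; rewrite asboolT //.
  by apply: lt_le_trans t_le; rewrite ltr_nat.
rewrite ler_pdivlMr //; apply: le_trans le4.
have P_ge0 : 0 <= Gnnp_prob p (fun G => (#|nonneighbours G X| < t)%N).
  rewrite Gnnp_probE; apply: sumr_ge0 => G _; apply: mulr_ge0 => //.
  by apply: weight_ge0 => //; apply: ltW.
have : h <= n%:R * (1 - p) ^+ #|X|.
  by apply: le_trans nq_ge _; rewrite ler_piMr // mulr_ge0 // exprn_ge0 // subr_ge0.
by move=> le_nq; rewrite mulrC ler_pM // ltW.
Qed.

Lemma disjoint_nonneighbours (G : bigraph n) X :
  [disjoint finset.setX X (nonneighbours G X) & G].
Proof.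
apply/fintype.pred0P => -[a b] /=; apply/negP => /andP[].
rewrite !inE /= => /andP[aX dXb] abG.
by have := disjointFl dXb abG; rewrite !inE aX eqxx.
Qed.

Lemma exists_disjoint_sets t : (2 * t <= n)%N ->
  exists X1 X2 : {set 'I_n}, [/\ [disjoint X1 & X2], #|X1| = t, #|X2| = t
    & #|X1 :|: X2| = (2 * t)%N].
Proof.
move=> le2t.
have [|X _ cX] := @exists_subset_card _ [set: 'I_n]%SET (2 * t).
  by rewrite cardsT card_ord.
have [|X1 sX1 cX1] := @exists_subset_card _ X t; first by rewrite cX; lia.
have cX2 : #|X :\: X1| = t.
  by move: (cardsID X1 X); rewrite (finset.setIidPr sX1) cX cX1; lia.
exists X1, (X :\: X1); split => //.
  by rewrite finset.disjoints_subset; apply/fintype.subsetP => a; rewrite !inE => ->.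
rewrite -cX; apply: eq_card => a; rewrite !inE.
by have [/(fintype.subsetP sX1)->|] := boolP (a \in X1).
Qed.

(** The numeric constants: holes are excluded at size m <= 4s + 1 <= 5s and
    found at size t >= s/4 - 1 >= s/8, where s = h/p is at least 24.
    Hence 18m <= 90s in (i) and t >= s/8 in (ii). *)
Lemma Gnnp_prob_near_cover : 24 <= h -> p <= 2^-1 ->
  1 - 5 / h <= Gnnp_prob p (fun G : bigraph n =>
      (forall col : coloring n,
         exists C1 C2 : bool * {set vertex n},
           [/\ mono_component G col C1, mono_component G col C2, C1 <> C2 &
               2 * n%:R - 90 * n%:R * expR (- h) <= #|C1.2 :|: C2.2|%:R])
      /\
      (exists col : coloring n,
         forall C1 C2 : bool * {set vertex n},
           mono_component G col C1 -> mono_component G col C2 ->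
           #|C1.2 :|: C2.2|%:R <= 2 * n%:R - 8^-1 * n%:R * expR (- h))).
Proof.
move=> h24 p2.
have h_gt0 : 0 < h by lra.
have s0 : 0 <= h / p by rewrite divr_ge0 // ltW.
have np_gt0 : 0 < n%:R * p by rewrite -hE mulr_gt0 ?expR_gt0.
have n_gt0 : (0 < n)%N by rewrite -(ltr0n R) -(pmulr_lgt0 _ p_gt0).
have s24 : 24 <= h / p by rewrite ler_pdivlMr //; nra.
have sle : h / p <= n%:R.
  by rewrite -nexpRN ler_piMr // expR_le1 oppr_le0 ltW.
pose m := (Num.truncn (4 * (h / p))).+1; pose t := Num.truncn (h / p / 4).
have /andP[m_gt m_le] : 4 * (h / p) <= m%:R <= 4 * (h / p) + 1.
  have : 0 <= 4 * (h / p) by lra.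
  by move=> /truncn_itv/andP[le4s lt4s]; rewrite (ltW lt4s) -[m%:R]natr1 lerD2r le4s.
have /andP[t_le t_gt] : t%:R <= h / p / 4 <= t%:R + 1.
  have : 0 <= h / p / 4 by lra.
  by move=> /truncn_itv/andP[let4 ltt4]; rewrite let4 natr1 ltW.
have [|X1 [X2 [dX cX1 cX2 cX]]] := @exists_disjoint_sets t.
  by rewrite -(ler_nat R) natrM; lra.
set P := (X in Gnnp_prob p X).
have := @Gnnp_prob_cover R n p (ltW p_gt0) p_le1 P (fun G => ~ hole_free m G)
  (fun G => (#|nonneighbours G (X1 :|: X2)| < t)%N).
have bad1 := @Gnnp_prob_hole_le m; have bad2 := @Gnnp_prob_no_hole (X1 :|: X2) t.
have {}bad1 := bad1 ltac:(lra) ltac:(rewrite -ler_pdivrMr //; lra).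
have {}bad2 := bad2 h_gt0 p2 ltac:(rewrite mulrA -ler_pdivlMr //; lra) cX.
move=> cov; have {cov} : 1 <= Gnnp_prob p P + h^-1 + 4 / h.
  apply: le_trans (cov _) _; last by rewrite !lerD.
  move=> G; have [hf|?] := pselect (hole_free m G); last by constructor 2.
  have [ltt|let_] := ltnP #|nonneighbours G (X1 :|: X2)| t; first by constructor 3.
  constructor 1; split => [col|].
    have [//|C1 [C2 [C1c C2c neC big]]] := @hole_free_two_components n m G col n_gt0 _ hf.
    exists C1, C2; split => //; rewrite -mulrA nexpRN.
    by move: big; rewrite -(ler_nat R) natrD !natrM; lra.
  have [||||col colP] := @hole_coloring n G X1 X2 (nonneighbours G (X1 :|: X2)) t dX.
  - exact: disjoint_nonneighbours.
  - by rewrite cX1.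
  - by rewrite cX2.
  - exact: let_.
  exists col => C1 C2 C1c C2c; rewrite -mulrA nexpRN.
  by move: (colP _ _ C1c C2c); rewrite -(ler_nat R) natrD natrM; lra.
by rewrite -{1}[h^-1]mul1r; lra.
Qed.

End HighProbability.

(** * The asymptotic statement *)

Local Open Scope classical_set_scope.
Local Open Scope ring_scope.

Theorem theorem1p4 (R : realType) :
  exists c C : R, 0 < c /\ 0 < C /\
  forall p h : nat -> R,
    (forall n : nat, 0 <= p n <= 1) ->
    n%:R * p n @[n --> \oo] --> +oo ->
    p n @[n --> \oo] --> (0 : R) ->
    (\forall n \near \oo, 0 < h n /\ h n * expR (h n) = n%:R * p n) ->
    whp p (fun (n : nat) (G : bigraph n) =>
      (forall col : coloring n,
         exists C1 C2 : bool * {set vertex n},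
           [/\ mono_component G col C1, mono_component G col C2, C1 <> C2 &
               2 * n%:R - C * n%:R * expR (- h n) <= #|C1.2 :|: C2.2|%:R])
      /\
      (exists col : coloring n,
         forall C1 C2 : bool * {set vertex n},
           mono_component G col C1 -> mono_component G col C2 ->
           #|C1.2 :|: C2.2|%:R <= 2 * n%:R - c * n%:R * expR (- h n))).
Proof.
exists 8^-1, 90; split; first by lra.
split=> // p h p01 np_oo p_0 hE.
(* h tends to infinity: h < M would give np = h e^h < M e^M. *)
have h_ge M : 0 < M -> \forall n \near \oo, M <= h n.
  move=> M0; have npM : \forall n \near \oo, M * expR M <= n%:R * p n.
    exact: (cvgryPge _).1 np_oo (M * expR M).
  near=> n; have [hn0 hnE] : 0 < h n /\ h n * expR (h n) = n%:R * p n by near: n.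
  have : M * expR M <= n%:R * p n by near: n.
  rewrite -hnE leNgt [M <= _]leNgt; apply: contra => ltM.
  by apply: ltr_pM; rewrite ?ltr_expR ?expR_ge0 ?(ltW hn0).
have p_le2 : \forall n \near \oo, p n <= 2^-1.
  move/cvgrPdist_le: p_0 => /(_ 2^-1 ltac:(by [])).
  apply: filterS => n; rewrite sub0r normrN => /(le_trans (ler_norm _)).
  exact.
have h_oo : h n @[n --> \oo] --> +oo.
  apply/cvgryPge => M; near=> n; apply: (@le_trans _ _ (Num.max M 1)).
    by rewrite le_max lexx.
  by near: n; apply: h_ge; rewrite lt_max ltr01 orbT.
rewrite /whp; apply: (@squeeze_cvgr _ _ _ _ (fun n => 1 - 5 / h n) (fun=> 1)).
- near=> n; have p_ge0 : 0 <= p n by case/andP: (p01 n).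
  have [hn0 hnE] : 0 < h n /\ h n * expR (h n) = n%:R * p n by near: n.
  have p_gt0 : 0 < p n.
    rewrite lt_neqAle p_ge0 eq_sym andbT; apply/eqP => pn0.
    by move: (mulr_gt0 hn0 (expR_gt0 (h n))); rewrite hnE pn0 mulr0 ltxx.
  have p_le1 : p n <= 1 by case/andP: (p01 n).
  rewrite Gnnp_prob_le1 // andbT; apply: (Gnnp_prob_near_cover p_gt0 p_le1 hnE).
    by near: n; apply: h_ge.
  by near: n.
- rewrite -[X in _ --> X]subr0; apply: cvgB; first exact: cvg_cst.
  rewrite -[X in _ --> X](mulr0 5); apply: cvgM; first exact: cvg_cst.
  by apply/(gtr0_cvgV0 _).2 => //; near=> n; apply: lt_le_trans ltr01 _; near: n; apply: h_ge.
- exact: cvg_cst.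
Unshelve. all: by end_near.
Qed.
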